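(* Let $(\mathcal A,\sigma)$ be an involutive ring. For all $M,N\in\mathrm{Mat}_2(\mathcal A)$, $$\mathrm{tr}(\mathrm{Adj}(M)N)+\mathrm{tr}(\sigma(M)N)-\sigma(\mathrm{tr}(M))\,\mathrm{tr}(N)=0 .$$
   Context: An involutive ring $(\mathcal A,\sigma)$ is a unital (possibly noncommutative) ring $\mathcal A$ with an anti-involution $\sigma$, i.e. $\sigma$ is additive, $\sigma(XY)=\sigma(Y)\sigma(X)$ and $\sigma(\sigma(X))=X$. For a $2\times2$ matrix $M=\begin{bmatrix}A&B\\C&D\end{bmatrix}$ over $\mathcal A$: $\sigma(M)$ denotes the entrywise application of $\sigma$ (no transposition), $\mathrm{tr}(M)=A+D\in\mathcal A$, and the adjoint matrix is $\mathrm{Adj}(M)=\begin{bmatrix}\sigma(D)&-\sigma(B)\\-\sigma(C)&\sigma(A)\end{bmatrix}$. *)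

(* Defs.v *)
From mathcomp Require Import all_boot all_order all_algebra.

Set Implicit Arguments.
Unset Strict Implicit.
Unset Printing Implicit Defensive.

Import GRing.Theory.
Local Open Scope ring_scope.

(* Rings are [pzRingType]: unital, possibly noncommutative, and the zero ring
   is allowed. *)
Record anti_involution (A : pzRingType) (sigma : A -> A) : Prop := AntiInvolution {
  anti_involutionD : {morph sigma : x y / x + y};
  anti_involutionM : forall x y, sigma (x * y) = sigma y * sigma x;
  anti_involutionK : involutive sigma
}.

Definition mx2 (A : pzRingType) (a b c d : A) : 'M[A]_2 :=
  \matrix_(i, j) if i == 0 then (if j == 0 then a else b)
                 else (if j == 0 then c else d).

(* This is not MathComp's adjugate [\adj M], which does not involve sigma. *)
Definition Adj (A : pzRingType) (sigma : A -> A) (M : 'M[A]_2) : 'M[A]_2 :=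
  mx2 (sigma (M 1 1)) (- sigma (M 0 1))
      (- sigma (M 1 0)) (sigma (M 0 0)).

(* Main.v *)
Require Import Defs.
From mathcomp Require Import all_boot all_order all_algebra.

Set Implicit Arguments.
Unset Strict Implicit.
Unset Printing Implicit Defensive.

Import GRing.Theory.
Local Open Scope ring_scope.

(** The adjoint is the [sigma]-twisted version of [tr(M) I - M], the
    Cayley-Hamilton form of the 2x2 adjugate: [Adj_add_map_mx] says that
    [Adj sigma M + map_mx sigma M] is the scalar matrix [sigma (\tr M)].
    Multiplying on the right by [N] then scales [N] on the left by
    [sigma (\tr M)], and the trace is left linear even when the ring is not
    commutative, so the scalar comes out in the required order. *)

(** Off the diagonal the entries cancel; on the diagonal both entries are
    the sum of [sigma (M 0 0)] and [sigma (M 1 1)], in one order or the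
    other. *)
Lemma Adj_add_map_mx (A : pzRingType) (sigma : A -> A) (M : 'M[A]_2) :
  {morph sigma : x y / x + y} ->
  Adj sigma M + map_mx sigma M = (sigma (\tr M))%:M.
Proof.
move=> sigmaD; rewrite /mxtrace big_ord_recl big_ord1.
have -> : lift ord0 ord0 = 1 :> 'I_2 by apply: val_inj.
rewrite sigmaD.
have ord2P (i : 'I_2) : i = 0 \/ i = 1.
  by case: i => [[|[|//]] lti]; [left | right]; apply: val_inj.
apply/matrixP => i j; rewrite !mxE.
case: (ord2P i) => ->; case: (ord2P j) => -> /=; rewrite ?mulr1n ?mulr0n ?addNr //.
by rewrite addrC.
Qed.

Theorem corollary4p2 (A : pzRingType) (sigma : A -> A)
  (hsigma : anti_involution sigma) (M N : 'M[A]_2) :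
  \tr (Adj sigma M *m N) + \tr (map_mx sigma M *m N)
    - sigma (\tr M) * \tr N = 0.
Proof.
rewrite -mxtraceD -mulmxDl (Adj_add_map_mx _ (anti_involutionD hsigma)).
by rewrite mul_scalar_mx mxtraceZ subrr.
Qed.
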